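(* There exist uncountably many pairwise non-similar nondegenerate tetrahedra in $\mathbb R^3$, each of which has an infinite degenerating LEB branch $(\Delta_n)_{n\ge 0}$ that obeys the opposite-edge tie-breaking rule at every step.
   Context: A nondegenerate tetrahedron is given by four affinely independent points of $\mathbb R^3$; two tetrahedra are similar if some Euclidean similarity maps the vertex set of one onto the vertex set of the other. Bisecting a tetrahedron at an edge $p_ip_j$ produces two children: one in which $p_i$ is replaced by the midpoint $\tfrac12(p_i+p_j)$ and one in which $p_j$ is replaced by it, the other vertices being unchanged. An LEB (Longest Edge Bisection) branch of $\Delta$ is a sequence $(\Delta_n)_{n\ge0}$ with $\Delta_0=\Delta$ such that, for each $n$, $\Delta_{n+1}$ is one of the two children obtained by bisecting $\Delta_n$ at some longest edge of $\Delta_n$. The branch obeys the opposite-edge tie-breaking rule if, at each step, the bisected edge is a longest edge whose opposite edge (the edge joining the other two vertices) has maximal length among the opposite edges of all the longest edges. Put $\vartheta(\Delta)=\operatorname{vol}(\Delta)/\operatorname{diam}(\Delta)^3$. The branch degenerates if $\vartheta(\Delta_n)\to0$ as $n\to\infty$. *)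

(* Defs.v *)
From mathcomp Require Import all_boot all_order all_algebra.
From mathcomp Require Import all_classical all_reals all_analysis.

Set Implicit Arguments.
Unset Strict Implicit.
Unset Printing Implicit Defensive.

Import Order.TTheory GRing.Theory Num.Theory.
Import numFieldNormedType.Exports.

Local Open Scope classical_set_scope.
Local Open Scope ring_scope.

Section Tetrahedra.
Context {R : realType}.

(* The norm that MathComp-Analysis puts on row vectors is the sup norm. *)
Definition dist (x y : 'rV[R]_3) : R :=
  Num.sqrt (\sum_(k < 3) (x 0 k - y 0 k) ^+ 2).

(* The vertices come labelled, and may be affinely dependent. *)
Definition tetrahedron := 'I_4 -> 'rV[R]_3.

Implicit Types (T U : tetrahedron) (D : nat -> tetrahedron) (i j k l : 'I_4).

Definition edge_vectors T : 'M[R]_3 :=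
  \matrix_(i < 3) (T (lift ord0 i) - T ord0).

(* Affine independence of the four vertices: the three vectors from the vertex
   of index 0 to the others are linearly independent. *)
Definition nondegenerate_tetrahedron T : Prop := row_free (edge_vectors T).

Definition similarity (f : 'rV[R]_3 -> 'rV[R]_3) : Prop :=
  exists2 c : R, 0 < c & forall x y, dist (f x) (f y) = c * dist x y.

(* Only the vertex sets matter, so relabelling a tetrahedron gives a similar
   one. *)
Definition similar_tetrahedra T U : Prop :=
  exists2 f, similarity f & f @` range T = range U.

Definition hull T : set 'rV[R]_3 :=
  [set x | exists w : 'I_4 -> R,
     [/\ forall i, 0 <= w i, \sum_i w i = 1 & x = \sum_i w i *: T i]].

Definition diam (A : set 'rV[R]_3) : R :=
  sup [set r | exists x y, [/\ A x, A y & r = dist x y]].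

(* One sixth of the volume of the parallelepiped on the edges at a vertex. *)
Definition vol T : R := `|\det (edge_vectors T)| / 6%:R.

Definition vartheta T : R := vol T / diam (hull T) ^+ 3.

Definition midpoint (x y : 'rV[R]_3) : 'rV[R]_3 := 2^-1 *: (x + y).

Definition replace_vertex T i (x : 'rV[R]_3) : tetrahedron :=
  fun k => if k == i then x else T k.

Definition is_child T i j U : Prop :=
  U = replace_vertex T i (midpoint (T i) (T j)) \/
  U = replace_vertex T j (midpoint (T i) (T j)).

Definition longest_edge T i j : Prop :=
  i != j /\ forall k l, dist (T k) (T l) <= dist (T i) (T j).

(* The edges ij and kl are opposite: the four indices are distinct. *)
Definition opposite_edges i j k l : bool := uniq [:: i; j; k; l].

Definition opposite_maximal T i j : Prop :=
  forall k l i' j' k' l',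
    opposite_edges i j k l ->
    longest_edge T i' j' -> opposite_edges i' j' k' l' ->
    dist (T k') (T l') <= dist (T k) (T l).

Definition leb_branch T D : Prop :=
  D 0%N = T /\
  forall n, exists i j, longest_edge (D n) i j /\ is_child (D n) i j (D n.+1).

Definition obeys_opposite_edge_rule D : Prop :=
  forall n, exists i j,
    [/\ longest_edge (D n) i j, opposite_maximal (D n) i j
      & is_child (D n) i j (D n.+1)].

Definition degenerates D : Prop :=
  (fun n => vartheta (D n)) @ \oo --> (0 : R).

End Tetrahedra.

Arguments tetrahedron : clear implicits.

(* Main.v *)
(** Let a tetrahedron have vertices A, B, C, P with AB^2 = AC^2 = s, BC^2 = s/2,
    and CP orthogonal to the plane ABC with CP^2 = u < 2s. Its longest edge is AP;
    bisect it at M and drop P. Now AB and AC are the longest edges, and the edge BM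
    opposite to AC is longer than the edge CM opposite to AB, so the rule bisects
    AC, at N say; drop A. The tetrahedron B, C, N, M is again of the initial form,
    with parameters s/2 and u/4. Two steps thus divide the volume by 4 and the scale
    s^(3/2) only by 2^(3/2), which makes the branch degenerate. The ratio of the
    extreme edge lengths separates the similarity classes. *)

Require Import Defs.
From mathcomp Require Import all_boot all_order all_algebra.
From mathcomp Require Import all_classical all_reals all_analysis.
From mathcomp Require Import ring lra.

Set Implicit Arguments.
Unset Strict Implicit.
Unset Printing Implicit Defensive.

Import Order.TTheory GRing.Theory Num.Theory.
Import numFieldNormedType.Exports.

Local Open Scope classical_set_scope.
Local Open Scope ring_scope.

(** * Squared distances, medians and opposite edges *)

Section Distances.
Context {R : realType}.
Implicit Types (x y z : 'rV[R]_3) (T : tetrahedron R) (i j k l : 'I_4).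

(** Squared lengths stay linear in the parameters [s] and [u] below, so [lra] can compare edges. *)
Definition sqdist x y : R := \sum_(k < 3) (x 0 k - y 0 k) ^+ 2.

Lemma sqdist_ge0 x y : 0 <= sqdist x y.
Proof. by apply: sumr_ge0 => k _; exact: sqr_ge0. Qed.

Lemma sqdistC x y : sqdist x y = sqdist y x.
Proof. by apply: eq_bigr => k _; rewrite -opprB sqrrN. Qed.

Lemma sqdistxx x : sqdist x x = 0.
Proof. by apply: big1 => k _; rewrite subrr expr0n. Qed.

Lemma distC x y : dist x y = dist y x.
Proof. by congr Num.sqrt; exact: sqdistC. Qed.

Lemma sqr_dist x y : dist x y ^+ 2 = sqdist x y.
Proof. by rewrite sqr_sqrtr ?sqdist_ge0. Qed.

Lemma dist_ge0 x y : 0 <= dist x y.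
Proof. exact: sqrtr_ge0. Qed.

Lemma ler_dist x y z t : (dist x y <= dist z t) = (sqdist x y <= sqdist z t).
Proof. by rewrite ler_sqrt ?sqdist_ge0. Qed.

(** Apollonius' median formula, the source of all lengths at new vertices. *)
Lemma sqdist_midpoint x y z :
  sqdist x (midpoint y z) = (sqdist x y + sqdist x z) / 2 - sqdist y z / 4.
Proof.
rewrite /sqdist -big_split !mulr_suml -sumrB; apply: eq_bigr => k _.
by rewrite !mxE /=; field.
Qed.

Lemma vertex_cases a b c p : uniq [:: a; b; c; p] ->
  forall k, [\/ k = a, k = b, k = c | k = p].
Proof.
move=> abcp k.
have /(_ k) : [:: a; b; c; p] =i 'I_4.
  have := uniq_min_size abcp (s2 := enum 'I_4).
  case=> [x _|//|_ E x]; rewrite ?mem_enum ?size_enum_ord //.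
  by rewrite E mem_enum.
rewrite !inE => /or4P[]/eqP->; by constructor.
Qed.

Lemma opposite_edges_dist T i j k l k' l' :
  opposite_edges i j k l -> opposite_edges i j k' l' ->
  dist (T k') (T l') = dist (T k) (T l).
Proof.
move=> ijkl; have cases := vertex_cases ijkl.
rewrite /opposite_edges /= !inE !negb_or -!andbA.
move=> /and5P[_ ik' il' jk' /and3P[jl' k'l' _]].
by case: (cases k') (cases l') => [E|E|E|E] [F|F|F|F]; subst;
  rewrite ?eqxx // in ik' il' jk' jl' k'l' *; rewrite distC.
Qed.

Lemma opposite_edges_swap i j k l : opposite_edges i j k l -> opposite_edges j i k l.
Proof.
rewrite /opposite_edges /= !inE !negb_or -!andbA.
by move=> /and5P[ij -> -> -> /and3P[-> -> _]]; rewrite eq_sym ij.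
Qed.

(** An edge determines its opposite edge up to orientation, so one labelling of the latter
    suffices. *)
Lemma opposite_maximalI T i j k l : opposite_edges i j k l ->
  (forall i' j' k' l', longest_edge T i' j' -> opposite_edges i' j' k' l' ->
     dist (T k') (T l') <= dist (T k) (T l)) ->
  opposite_maximal T i j.
Proof.
move=> ijkl H k1 l1 i' j' k' l' ijkl1 lij opp.
by rewrite (opposite_edges_dist T ijkl ijkl1); exact: H lij opp.
Qed.

End Distances.

(** * Halving of the volume under bisection *)

Section Volume.
Context {R : realType}.
Implicit Types (T : tetrahedron R) (i j : 'I_4).

Definition bisect T i j := replace_vertex T j (midpoint (T i) (T j)).

Lemma bisect_new T i j : bisect T i j j = midpoint (T i) (T j).
Proof. by rewrite /bisect /replace_vertex eqxx. Qed.

Lemma bisect_old T i j k : k != j -> bisect T i j k = T k.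
Proof. by rewrite /bisect /replace_vertex => /negPf->. Qed.

Definition coordinate T (m n : nat) : R := T (inord m) 0 (inord n).

Lemma det_edge_vectors T :
  let e m n := coordinate T m.+1 n - coordinate T 0 n in
  \det (edge_vectors T) =
    e 0 0 * (e 1 1 * e 2 2 - e 1 2 * e 2 1) - e 0 1 * (e 1 0 * e 2 2 - e 1 2 * e 2 0)
    + e 0 2 * (e 1 0 * e 2 1 - e 1 1 * e 2 0).
Proof.
move=> e; have -> : edge_vectors T = \matrix_(i < 3, j < 3) e i j.
  have e0 : inord 0 = ord0 :> 'I_4 by apply/val_inj; rewrite /= inordK.
  have eS (i : 'I_3) : inord i.+1 = lift ord0 i.
    by apply/val_inj; rewrite /= inordK// ltnS.
  by apply/matrixP => i j; rewrite !mxE /e /coordinate inord_val eS e0.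
rewrite (expand_det_row _ 0) !big_ord_recl big_ord0 /cofactor.
rewrite !(expand_det_row _ 0) !big_ord_recl !big_ord0 /cofactor !det_mx11 !mxE /=.
rewrite /bump /= !(addn0, add0n) /=.
by move: e => e; ring.
Qed.

Lemma coordinate_bisect T (m0 n0 m n : nat) : (n0 < 4)%N -> (m < 4)%N ->
  coordinate (bisect T (inord m0) (inord n0)) m n =
  if m == n0 :> nat then (coordinate T m0 n + coordinate T n0 n) / 2 else coordinate T m n.
Proof.
move=> n4 m4; rewrite /coordinate /bisect /replace_vertex -val_eqE /= !inordK //.
by case: ifP => //; rewrite !mxE mulrC.
Qed.

(** The determinant is affine in the vertex of index [j] and vanishes when [T i] is put there, so
    the midpoint gives half of it. The polynomial identity is checked for each pair of indices. *)
Lemma vol_bisect T i j : i != j -> vol (bisect T i j) = vol T / 2.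
Proof.
move=> ij; rewrite /vol.
suff -> : \det (edge_vectors (bisect T i j)) = \det (edge_vectors T) / 2.
  by rewrite normrM (ger0_norm (_ : 0 <= 2^-1)) ?invr_ge0// mulrAC.
rewrite -[i]inord_val -[j]inord_val !det_edge_vectors !coordinate_bisect//.
case: i j ij => [[|[|[|[|//]]]] ?] [[|[|[|[|//]]]] ?]; rewrite -val_eqE //= => _; by field.
Qed.

End Volume.

(** * The shape of the tetrahedra and its cycle of two bisections *)

Section Tower.
Context {R : realType}.
Implicit Types (T : tetrahedron R) (s u : R) (a b c p : 'I_4).

(** By Pythagoras, the last three lengths express that CP is orthogonal to CA and CB. The indices
    are parameters because the roles of the vertices permute from one cycle to the next. *)
Record tower T a b c p s u : Prop := Tower {
  tower_uniq : uniq [:: a; b; c; p];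
  tower_ab : sqdist (T a) (T b) = s;
  tower_ac : sqdist (T a) (T c) = s;
  tower_bc : sqdist (T b) (T c) = s / 2;
  tower_ap : sqdist (T a) (T p) = s + u;
  tower_bp : sqdist (T b) (T p) = s / 2 + u;
  tower_cp : sqdist (T c) (T p) = u }.

Definition rule_edge T i j := longest_edge T i j /\ opposite_maximal T i j.

(** Since [s + u] strictly exceeds the other five squared lengths, AP is the only longest edge and
    there is no tie to break. *)
Lemma tower_first_step T a b c p s u : tower T a b c p s u -> 0 < s -> 0 < u ->
  rule_edge T a p.
Proof.
move=> [abcp ab ac bc ap bp cp] s0 u0.
have cases := vertex_cases abcp.
have E := (ab, ac, bc, ap, bp, cp, @sqdistxx R).
have E' := (sqdistC (T b) (T a), sqdistC (T c) (T a), sqdistC (T c) (T b),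
            sqdistC (T p) (T a), sqdistC (T p) (T b), sqdistC (T p) (T c)).
have apbc : opposite_edges a p b c.
  move: abcp; rewrite /opposite_edges /= !inE !negb_or -!andbA.
  by move=> /and5P[-> -> -> -> /andP[]]; rewrite eq_sym => -> /andP[]; rewrite eq_sym => ->.
split.
  split=> [|k l]; first by move: apbc => /= /andP[]; rewrite !inE !negb_or => /andP[].
  by rewrite ler_dist; case: (cases k) => ->; case: (cases l) => ->;
    rewrite ?E' ?E; lra.
apply: (opposite_maximalI apbc) => i j k l [_ /(_ a p)]; rewrite ler_dist => H ijkl.
suff /(opposite_edges_dist T apbc)-> : opposite_edges a p k l by [].
move: ijkl H; case: (cases i) => ->; case: (cases j) => -> opp; rewrite ?E' ?E => H;
  do ?[by []|exact: opposite_edges_swap|lra].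
Qed.

(** The bound [u < 2 * s] keeps BM, of square [s / 2 + u / 4], shorter than AB and AC, which tie.
    The square of CM is [(s + u) / 4], smaller than that of BM by [s / 4]. *)
Lemma tower_second_step T a b c p s u : tower T a b c p s u -> 0 < s -> 0 < u ->
  u < 2 * s -> rule_edge (bisect T a p) c a.
Proof.
move=> [abcp ab ac bc ap bp cp] s0 u0 us.
have cases := vertex_cases abcp.
have cabp : opposite_edges c a b p /\ opposite_edges a b c p.
  split=> //; move: abcp; rewrite /opposite_edges /= !inE !negb_or -!andbA.
  move=> /and5P[-> + -> + /andP[-> /andP[-> _]]]; rewrite eq_sym => ->.
  by rewrite eq_sym => ->.
have [[pa pb] pc] : (a != p /\ b != p) /\ c != p.
  by move: abcp; rewrite /= !inE !negb_or -!andbA => /and5P[_ _ -> _ /and3P[-> ->]].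
set U := bisect T a p.
have Ua : U a = T a by rewrite /U bisect_old.
have Ub : U b = T b by rewrite /U bisect_old.
have Uc : U c = T c by rewrite /U bisect_old.
have Up : U p = midpoint (T a) (T p) by rewrite /U bisect_new.
have Uab : sqdist (U a) (U b) = s by rewrite Ua Ub.
have Uac : sqdist (U a) (U c) = s by rewrite Ua Uc.
have Ubc : sqdist (U b) (U c) = s / 2 by rewrite Ub Uc.
have Uap : sqdist (U a) (U p) = (s + u) / 4.
  by rewrite Ua Up sqdist_midpoint sqdistxx ap; field.
have Ubp : sqdist (U b) (U p) = s / 2 + u / 4.
  by rewrite Ub Up sqdist_midpoint (sqdistC (T b) (T a)) ab bp ap; field.
have Ucp : sqdist (U c) (U p) = (s + u) / 4.
  by rewrite Uc Up sqdist_midpoint (sqdistC (T c) (T a)) ac cp ap; field.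
have E := (Uab, Uac, Ubc, Uap, Ubp, Ucp, @sqdistxx R).
have E' := (sqdistC (U b) (U a), sqdistC (U c) (U a), sqdistC (U c) (U b),
            sqdistC (U p) (U a), sqdistC (U p) (U b), sqdistC (U p) (U c)).
case: cabp => cabp abcp'.
split.
  split=> [|k l]; first by move: cabp => /= /andP[]; rewrite !inE !negb_or => /andP[].
  by rewrite ler_dist; case: (cases k) => ->; case: (cases l) => ->;
    rewrite ?E' ?E; lra.
apply: (opposite_maximalI cabp) => i j k l [_ /(_ a c)]; rewrite ler_dist => H ijkl.
(* Only AC and AB are longest, so the competing opposite edge is BM or CM. *)
suff [/(opposite_edges_dist U cabp)->//|/(opposite_edges_dist U abcp')->] :
    opposite_edges c a k l \/ opposite_edges a b k l.
  by rewrite ler_dist !E; lra.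
move: ijkl H; case: (cases i) => ->; case: (cases j) => -> opp; rewrite ?E' ?E => H;
  do ?[by []|by left|by right|by left; exact: opposite_edges_swap
      |by right; exact: opposite_edges_swap|lra].
Qed.

(** B takes the role of A, C that of B, and the midpoints N and M, stored at [a] and [p], those of C
    and P. Orthogonality persists because NM is the midline of ACP parallel to CP. *)
Lemma tower_double_step T a b c p s u : tower T a b c p s u ->
  tower (bisect (bisect T a p) c a) b c a p (s / 2) (u / 4).
Proof.
move=> [abcp ab ac bc ap bp cp].
have := abcp; rewrite /= !inE !negb_or -!andbA => /and5P[nab nac nap nbc /and3P[nbp ncp _]].
have ba : b != a by rewrite eq_sym.
have ca : c != a by rewrite eq_sym.
have pa : p != a by rewrite eq_sym.
have Up : bisect (bisect T a p) c a p = midpoint (T a) (T p).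
  by rewrite bisect_old// bisect_new.
have Ua : bisect (bisect T a p) c a a = midpoint (T c) (T a).
  by rewrite bisect_new !bisect_old.
have Ub : bisect (bisect T a p) c a b = T b by rewrite !bisect_old.
have Uc : bisect (bisect T a p) c a c = T c by rewrite !bisect_old.
have E := (ab, ac, bc, ap, bp, cp, @sqdistxx R).
have E' := (sqdistC (T b) (T a), sqdistC (T c) (T a), sqdistC (T c) (T b),
            sqdistC (T p) (T a), sqdistC (T p) (T b), sqdistC (T p) (T c)).
by split; rewrite ?Ua ?Ub ?Uc ?Up ?(sqdistC (midpoint (T c) (T a))) ?sqdist_midpoint
  ?(sqdistC (midpoint _ _)) ?sqdist_midpoint ?E' ?E;
  first [by rewrite /= !inE !negb_or ba nbc nbp ca ncp nap | field].
Qed.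

End Tower.

(** * The infinite branch, its volumes and a long edge at each stage *)

Section Branch.
Context {R : realType}.
Implicit Types (T : tetrahedron R) (s u : R) (a b c p i j : 'I_4).

Fixpoint tower_branch T a b c p n : tetrahedron R :=
  match n with
  | 0 => T
  | 1 => bisect T a p
  | m.+2 => tower_branch (bisect (bisect T a p) c a) b c a p m
  end.

Lemma tower_branch_step T a b c p s u n :
  tower T a b c p s u -> 0 < s -> 0 < u -> u < 2 * s ->
  let D := tower_branch T a b c p in
  exists i j, rule_edge (D n) i j /\ D n.+1 = bisect (D n) i j.
Proof.
move=> + + + + D; rewrite {}/D.
have [m] := ubnP n; elim: m n T a b c p s u => // m IH.
move=> [|[|n]] T a b c p s u nm tow s0 u0 us.
- by exists a, p; split=> //; exact: tower_first_step tow s0 u0.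
- by exists c, a; split=> //; exact: tower_second_step tow s0 u0 us.
(* A cycle halves the ratio of [u] to [s], so the bound [u < 2 * s] persists. *)
- apply: (IH n _ _ _ _ _ (s / 2) (u / 4)); [exact: ltnW| |lra..].
  exact: tower_double_step.
Qed.

Lemma vol_tower_branch T a b c p s u n :
  tower T a b c p s u -> 0 < s -> 0 < u -> u < 2 * s ->
  vol (tower_branch T a b c p n) = vol T / 2 ^+ n.
Proof.
move=> tow s0 u0 us; elim: n => [|n IH]; first by rewrite divr1.
have [i [j [[[ij _] _] ->]]] := tower_branch_step n tow s0 u0 us.
by rewrite vol_bisect// IH exprSr invfM mulrA.
Qed.

(** AB survives the first bisection of a cycle, and each full cycle halves [s]; hence the exponent
    [n./2]. *)
Lemma tower_branch_edge T a b c p s u n : tower T a b c p s u ->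
  exists i j, s / 2 ^+ n./2 <= sqdist (tower_branch T a b c p n i) (tower_branch T a b c p n j).
Proof.
have [m] := ubnP n; elim: m n T a b c p s u => // m IH.
move=> [|[|n]] T a b c p s u nm tow; last 1 first.
- have [|i [j ij]] := IH n _ _ _ _ _ _ _ _ (tower_double_step tow); first exact: ltnW.
  by exists i, j; rewrite /= exprS invfM mulrA.
- by exists a, b; rewrite (tower_ab tow) divr1.
- have := tower_uniq tow; rewrite /= !inE !negb_or -!andbA.
  move=> /and5P[_ _ ap _ /andP[bp _]].
  by exists a, b; rewrite /= !bisect_old// (tower_ab tow) divr1.
Qed.

End Branch.

(** * The diameter of the hull and degeneration *)

Section Diameter.
Context {R : realType}.
Implicit Types (T : tetrahedron R) (i j : 'I_4).

Lemma hull_vertex T i : hull T (T i).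
Proof.
exists (fun k => (k == i)%:R); split.
- by move=> k; rewrite ler0n.
- by rewrite (bigD1 i)//= eqxx big1 ?addr0// => k /negPf->.
- rewrite (bigD1 i)//= eqxx scale1r big1 ?addr0// => k /negPf->.
  by rewrite scale0r.
Qed.

(** Makes the supremum in [diam] a genuine one: on an unbounded set [sup] is only a default
    value. *)
Lemma hull_bounded T : exists M, forall x, hull T x -> forall k, `|x 0 k| <= M.
Proof.
exists (\sum_i \sum_k `|T i 0 k|) => x [w [w0 w1 ->]] k.
rewrite summxE (le_trans (ler_norm_sum _ _ _))//; apply: ler_sum => i _.
have wi1 : w i <= 1.
  by rewrite -w1 (bigD1 i)//= lerDl sumr_ge0.
rewrite mxE normrM ger0_norm// (le_trans (ler_piMl _ wi1))//.
by rewrite (bigD1 k)//= lerDl sumr_ge0.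
Qed.

Lemma dist_le_diam_hull T i j : dist (T i) (T j) <= diam (hull T).
Proof.
apply: ub_le_sup; last by exists (T i), (T j); split=> //; exact: hull_vertex.
have [M xM] := hull_bounded T.
exists (Num.sqrt (\sum_(k < 3) (M + M) ^+ 2)) => _ [x [y [/xM xk /xM yk ->]]].
apply: ler_wsqrtr; apply: ler_sum => k _.
rewrite -real_normK ?num_real// lerXn2r// ?nnegrE ?normr_ge0//.
  by rewrite addr_ge0// (le_trans _ (xk k)).
by rewrite (le_trans (ler_normB _ _))// lerD.
Qed.

(* With [r ^+ 4 = 1/2], [n] bisections multiply the volume by [r ^+ (4 * n)] and
   keep the diameter at least [sqrt s * r ^+ n]. *)
Lemma tower_branch_degenerates T a b c p s u :
  tower T a b c p s u -> 0 < s -> 0 < u -> u < 2 * s ->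
  degenerates (tower_branch T a b c p).
Proof.
move=> tow s0 u0 us; set D := tower_branch T a b c p.
pose r : R := Num.sqrt (Num.sqrt 2^-1).
have r0 : 0 < r by rewrite !sqrtr_gt0 invr_gt0.
have r4 : r ^+ 4 = 2^-1 by rewrite (exprM _ 2 2) !sqr_sqrtr ?sqrtr_ge0 ?invr_ge0.
have r1 : r < 1.
  rewrite ltNge; apply/negP => /(exprn_ege1 4); rewrite r4; lra.
have q0 : 0 < Num.sqrt s by rewrite sqrtr_gt0.
have diamD n : Num.sqrt s * r ^+ n <= diam (hull (D n)).
  have [i [j ij]] := tower_branch_edge n tow.
  apply: le_trans (dist_le_diam_hull _ i j).
  rewrite -(@ler_pXn2r _ 2)// ?nnegrE ?dist_ge0 ?mulr_ge0 ?sqrtr_ge0 ?exprn_ge0 ?(ltW r0)//.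
  rewrite sqr_dist exprMn sqr_sqrtr ?(ltW s0)//; apply: le_trans ij.
  (* Rounding down in [n./2] is harmless, as [r < 1] and [4 * n./2 <= 2 * n]. *)
  rewrite ler_pM2l// -exprVn -r4 -!exprM ler_wiXn2l//; try exact: ltW.
  by rewrite -[4%N]/(2 * 2)%N -mulnA mulnC leq_pmul2r// mul2n -geq_half_double.
have varthetaD n : 0 <= vartheta (D n) <= vol T / Num.sqrt s ^+ 3 * r ^+ n.
  have d0 : 0 < diam (hull (D n)) by rewrite (lt_le_trans _ (diamD n))// mulr_gt0 ?exprn_gt0.
  have v0 : 0 <= vol T by rewrite divr_ge0.
  rewrite /vartheta divr_ge0 ?exprn_ge0 ?(ltW d0)//; last by rewrite divr_ge0.
  rewrite (vol_tower_branch n tow s0 u0 us) /=.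
  rewrite ler_pdivrMr ?exprn_gt0//.
  (* Of the volume factor [r ^+ (4 * n)], the cubed diameter absorbs [r ^+ (3 * n)], and [r ^+ n]
     remains. *)
  have -> : vol T / 2 ^+ n = vol T / Num.sqrt s ^+ 3 * r ^+ n * (Num.sqrt s * r ^+ n) ^+ 3.
    by rewrite -exprVn -r4 exprAC; field; rewrite gt_eqF.
  apply: ler_wpM2l; first by rewrite mulr_ge0 ?divr_ge0 ?exprn_ge0 ?(ltW q0) ?(ltW r0).
  by rewrite lerXn2r ?nnegrE ?(ltW d0)// mulr_ge0 ?exprn_ge0 ?(ltW q0) ?(ltW r0).
apply: (@squeeze_cvgr _ _ _ _ (fun=> 0) (fun n => vol T / Num.sqrt s ^+ 3 * r ^+ n)).
- by apply: nearW => n; exact: varthetaD.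
- exact: cvg_cst.
- by apply: cvg_geometric; rewrite ger0_norm ?ltW.
Qed.

End Diameter.

(** * Similarity classes separated by the extreme edges *)

Section Similarity.
Context {R : realType}.
Implicit Types (T U : tetrahedron R) (s u : R) (a b c p k l : 'I_4).

(** For [u <= s / 2] the extreme edges are CP and AP; positivity excludes [k = l]. *)
Lemma tower_sqdist_bounds T a b c p s u : tower T a b c p s u -> 0 < u -> u <= s / 2 ->
  forall k l, sqdist (T k) (T l) <= s + u /\
    (0 < sqdist (T k) (T l) -> u <= sqdist (T k) (T l)).
Proof.
move=> [abcp ab ac bc ap bp cp] u0 us k l; have cases := vertex_cases abcp.
have E := (ab, ac, bc, ap, bp, cp, @sqdistxx R).
have E' := (sqdistC (T b) (T a), sqdistC (T c) (T a), sqdistC (T c) (T b),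
            sqdistC (T p) (T a), sqdistC (T p) (T b), sqdistC (T p) (T c)).
by case: (cases k) => ->; case: (cases l) => ->; rewrite ?E' ?E; split; lra.
Qed.

(** A similarity of factor [m] multiplies the extremes [u] and [s + u] by [m ^+ 2], hence also their
    difference [s]. *)
Lemma similar_towers_ratio T U a b c p a' b' c' p' s u s' u' :
  tower T a b c p s u -> 0 < u -> u <= s / 2 ->
  tower U a' b' c' p' s' u' -> 0 < u' -> u' <= s' / 2 ->
  similar_tetrahedra T U -> u * s' = u' * s.
Proof.
move=> towT u0 us towU u'0 us' [f [m m0 fm] fTU].
have sqf x y : sqdist (f x) (f y) = m ^+ 2 * sqdist x y.
  by rewrite -!sqr_dist fm exprMn.
have T_U k : exists k', f (T k) = U k'.
  have : range U (f (T k)) by rewrite -fTU; exists (T k) => //; exists k.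
  by case=> k' _ <-; exists k'.
have U_T k : exists k', U k = f (T k').
  have : (f @` range T) (U k) by rewrite fTU; exists k.
  by case=> _ [k' _ <-] <-; exists k'.
have m2 : 0 < m ^+ 2 by rewrite exprn_gt0.
(* Each of the four inequalities carries an extreme edge of one tetrahedron to some pair of vertices
   of the other. *)
have le1 : m ^+ 2 * (s + u) <= s' + u'.
  have [[x Tx] [y Ty]] := (T_U a, T_U p).
  rewrite -(tower_ap towT) -sqf Tx Ty.
  exact: (tower_sqdist_bounds towU _ _ _ _).1.
have le2 : s' + u' <= m ^+ 2 * (s + u).
  have [[x Ux] [y Uy]] := (U_T a', U_T p').
  rewrite -(tower_ap towU) Ux Uy sqf ler_pM2l//.
  exact: (tower_sqdist_bounds towT _ _ _ _).1.
have le3 : u' <= m ^+ 2 * u.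
  have [[x Tx] [y Ty]] := (T_U c, T_U p).
  (* Positivity shows that the images of C and P differ, as the lower bound requires. *)
  have : 0 < m ^+ 2 * u by rewrite mulr_gt0.
  rewrite -{1 2}(tower_cp towT) -sqf Tx Ty.
  exact: (tower_sqdist_bounds towU _ _ _ _).2.
have le4 : m ^+ 2 * u <= u'.
  have [[x Ux] [y Uy]] := (U_T c', U_T p').
  have := u'0; rewrite -{1 2}(tower_cp towU) Ux Uy sqf ler_pM2l// pmulr_rgt0//.
  exact: (tower_sqdist_bounds towT _ _ _ _).2.
have -> : u' = m ^+ 2 * u by apply/le_anti; rewrite le3.
have -> : s' = m ^+ 2 * s by lra.
by ring.
Qed.

End Similarity.

(** * An explicit one-parameter family *)

Section Family.
Context {R : realType}.
Implicit Types h : R.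

(** The base has AB^2 = 9 + 7 = 16 = AC^2 and BC^2 = 1 + 7 = 8, so [s] is 16; [h] is the height of P
    above C. *)
Definition family_tower h : tetrahedron R := fun i => \row_(k < 3)
  nth 0 (nth [::] [:: [:: 0; 0; 0]; [:: 3; Num.sqrt 7; 0]; [:: 4; 0; 0]; [:: 4; 0; h]] i) k.

Lemma tower_family h : tower (family_tower h)
  (@Ordinal 4 0 isT) (@Ordinal 4 1 isT) (@Ordinal 4 2 isT) (@Ordinal 4 3 isT) 16 (h ^+ 2).
Proof.
have q7 : Num.sqrt 7 ^+ 2 = 7 :> R by rewrite sqr_sqrtr.
by split=> //; rewrite /sqdist !big_ord_recl big_ord0 !mxE /=; lra.
Qed.

Lemma nondegenerate_family h : 0 < h -> nondegenerate_tetrahedron (family_tower h).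
Proof.
move=> h0; rewrite /nondegenerate_tetrahedron row_free_unit unitmxE unitfE.
rewrite det_edge_vectors /coordinate !mxE !inordK//=.
have q7 : 0 < Num.sqrt 7 :> R by rewrite sqrtr_gt0.
(* The determinant equals [- 4 * Num.sqrt 7 * h], which is negative. *)
by rewrite lt_eqF//; nra.
Qed.

Lemma family_tower_inj : injective family_tower.
Proof.
move=> h k /(congr1 (fun T : tetrahedron R => T (@Ordinal 4 3 isT) 0 (@Ordinal 3 2 isT))).
by rewrite !mxE.
Qed.

(** Injectivity reduces this to the interval, whose Lebesgue measure is 1, whereas countable sets
    have measure 0. *)
Lemma uncountable_family : ~ countable (family_tower @` `]0, 1[).
Proof.
have /eq_countable -> := inj_card_eq (in2W family_tower_inj : {in `]0, 1[%classic &, _}).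
move=> /countable_lebesgue_measure0.
by rewrite lebesgue_measure_itv /= lte_fin ltr01 oppr0 adde0 => /eqP; rewrite eqe oner_eq0.
Qed.

End Family.

Theorem theorem1p1 (R : realType) :
  exists S : set (tetrahedron R),
    [/\ ~ countable S,
        forall T U : tetrahedron R, S T -> S U -> T <> U -> ~ similar_tetrahedra T U
      & forall T : tetrahedron R, S T ->
          nondegenerate_tetrahedron T /\
          exists D : nat -> tetrahedron R,
            [/\ leb_branch T D, obeys_opposite_edge_rule D & degenerates D]].
Proof.
exists (family_tower @` `]0, 1[); split; first exact: uncountable_family.
- move=> _ _ [h /itvP h01 <-] [k /itvP k01 <-] hk; apply: contra_not hk => sim.
  have [h0 h1] : 0 < h /\ h < 1 by rewrite !h01.
  have [k0 k1] : 0 < k /\ k < 1 by rewrite !k01.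
  have h2 : 0 < h ^+ 2 by rewrite exprn_gt0.
  have k2 : 0 < k ^+ 2 by rewrite exprn_gt0.
  have h8 : h ^+ 2 <= 16 / 2 by nra.
  have k8 : k ^+ 2 <= 16 / 2 by nra.
  have := similar_towers_ratio (tower_family h) h2 h8 (tower_family k) k2 k8 sim.
  (* The ratio identity reads [h ^+ 2 * 16 = k ^+ 2 * 16], with [h] and [k] positive. *)
  by move=> hk; congr family_tower; nra.
- move=> _ [h /itvP h01 <-].
  have h0 : 0 < h by rewrite h01.
  have h1 : h < 1 by rewrite h01.
  have u0 : 0 < h ^+ 2 by rewrite exprn_gt0.
  have u32 : h ^+ 2 < 2 * 16 by nra.
  have tow := tower_family h; have s0 : 0 < 16 :> R by [].
  have step n := tower_branch_step n tow s0 u0 u32.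
  split; first exact: nondegenerate_family.
  exists (tower_branch (family_tower h) (@Ordinal 4 0 isT) (@Ordinal 4 1 isT)
    (@Ordinal 4 2 isT) (@Ordinal 4 3 isT)); split.
  + split=> // n; have [i [j [[ij _] E]]] := step n.
    by exists i, j; split=> //; right.
  + move=> n; have [i [j [[ij opp] E]]] := step n.
    by exists i, j; split=> //; right.
  + exact: tower_branch_degenerates tow s0 u0 u32.
Qed.
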